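(* Let $\Lambda$ be a countable group, $H,K$ subgroups of $\Lambda$, $\phi:H\to K$ an isomorphism, and let $\Gamma=HNN(\Lambda,H,K,\phi)$. Suppose that for every integer $n\geqslant 1$ there exist elements $h_0^{(n)},h_1^{(n)},\ldots,h_n^{(n)}\in (Z(\Lambda)\cap H\cap K)^*$ such that $h_i^{(n)}=\phi(h_{i-1}^{(n)})$ for $i=1,\ldots,n$. Then $\Gamma$ is inner amenable.
   Context: For a group $G$, $G^*=G\setminus\{1\}$ and $Z(G)$ denotes the center of $G$. The HNN extension is $HNN(\Lambda,H,K,\phi)=\langle \Lambda,t\mid t^{-1}ht=\phi(h)\ \forall h\in H\rangle$, where $H,K\leq\Lambda$ and $\phi:H\to K$ is an isomorphism. A (discrete, countable) group $G$ is inner amenable if $G=\{1\}$ or if there is a linear form $m:\ell^\infty(G^* )\to\mathbb{C}$ that is positive ($m(f)\geqslant0$ whenever $f\geqslant 0$), normalized ($m(1)=1$), and invariant under inner automorphisms: $m(f\circ g^{-1})=m(f)$ for all $g\in G$ and $f\in\ell^\infty(G^* )$, where $g$ also denotes the map $x\mapsto gxg^{-1}$ on $G^*$. *)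

(* Defs.v *)
From HB Require Import structures.
From mathcomp Require Import all_boot all_order all_algebra.
From mathcomp Require Import generic_quotient.
From mathcomp Require Import all_classical all_reals all_analysis.
From mathcomp Require Import complex.

Set Implicit Arguments.
Unset Strict Implicit.
Unset Printing Implicit Defensive.
Import Order.TTheory GRing.Theory Num.Theory.
Import numFieldNormedType.Exports.
Local Open Scope quotient_scope.

(* Groups are arbitrary (possibly infinite)
   [groupType]s, subgroups are [groupClosed] predicates; [gsub H] is the
   subgroup H seen as a group in its own right. *)

Section Subgroup.
Variables (L : groupType) (H : groupClosed L).

Definition gsub : Type := {x : L | x \in H}.

HB.instance Definition _ := SubChoice.on gsub.

Fact gsub_group_closed : group_closed (fun x : L => x \in H).
Proof. by split; [exact: gpred1 | exact: gpredF]. Qed.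

HB.instance Definition _ :=
  SubChoice_isSubGroup.Build L (fun x : L => x \in H) gsub gsub_group_closed.

End Subgroup.

Definition gcenter (G : groupType) : set G := [set z | forall x : G, commute z x].

Arguments gcenter : clear implicits.

(* [HNN phi] is the group with presentation < L, t | t^-1 h t = phi h, h in H >:
   words in the letters [inl a] (a in L), [inr true] (t) and [inr false] (t^-1),
   modulo the least congruence [hnn_eqv] that contains the multiplication table
   of L, the cancellations between t and t^-1, and the HNN relations. *)

Section HNN.
Variables (L : groupType) (H K : groupClosed L) (phi : gsub H -> gsub K).

Definition hnn_word := seq (L + bool)%type.

HB.instance Definition _ := Choice.on hnn_word.

Inductive hnn_eqv : hnn_word -> hnn_word -> Prop :=
| hnn_refl u : hnn_eqv u u
| hnn_sym u v : hnn_eqv u v -> hnn_eqv v u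
| hnn_trans u v w : hnn_eqv u v -> hnn_eqv v w -> hnn_eqv u w
| hnn_cat u u' v v' : hnn_eqv u u' -> hnn_eqv v v' -> hnn_eqv (u ++ v) (u' ++ v')
| hnn_one : hnn_eqv [:: inl 1%g] [::]
| hnn_mul a b : hnn_eqv [:: inl a; inl b] [:: inl (a * b)%g]
| hnn_tV b : hnn_eqv [:: inr b; inr (~~ b)] [::]
| hnn_conj h : hnn_eqv [:: inr false; inl (val h); inr true] [:: inl (val (phi h))].

Definition hnn_eqvb : rel hnn_word := fun u v => `[< hnn_eqv u v >].

Fact hnn_eqvb_equiv : equiv_class_of hnn_eqvb.
Proof.
split=> [u|u v|v u w].
- exact/asboolP/hnn_refl.
- by apply/asboolP/asboolP => /hnn_sym.
- by move=> /asboolP uv /asboolP vw; apply/asboolP/(hnn_trans uv).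
Qed.

Canonical hnn_equiv_rel := EquivRelPack hnn_eqvb_equiv.

Definition HNN : Type := {eq_quot hnn_equiv_rel}.

HB.instance Definition _ := Choice.on HNN.
HB.instance Definition _ := Quotient.on HNN.

Definition hnn_class (u : hnn_word) : HNN := \pi u.

Lemma hnn_classP u v : hnn_class u = hnn_class v <-> hnn_eqv u v.
Proof. by split=> [/eqmodP/asboolP|uv]; last exact/eqmodP/asboolP. Qed.

Lemma hnn_classK (x : HNN) : hnn_class (repr x) = x.
Proof. exact: reprK. Qed.

Definition hnn_letterV (l : (L + bool)%type) : (L + bool)%type :=
  match l with inl a => inl a^-1%g | inr b => inr (~~ b) end.

Definition hnn_wordV (u : hnn_word) : hnn_word := rev (map hnn_letterV u).

Definition hnn_mulg (x y : HNN) : HNN := hnn_class (repr x ++ repr y).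
Definition hnn_invg (x : HNN) : HNN := hnn_class (hnn_wordV (repr x)).

Lemma hnn_wordVr u : hnn_eqv (u ++ hnn_wordV u) [::].
Proof.
elim: u => [|l u IH]; first exact: hnn_refl.
rewrite /hnn_wordV map_cons rev_cons -cats1 -cat1s catA -(catA [:: l]).
apply: (@hnn_trans _ (([:: l] ++ [::]) ++ [:: hnn_letterV l])).
  by apply: hnn_cat (hnn_refl _); apply: hnn_cat (hnn_refl _) IH.
case: l => [a|b] /=; last exact: hnn_tV.
by apply: hnn_trans (hnn_mul _ _) _; rewrite mulgV; exact: hnn_one.
Qed.

Lemma hnn_wordVK : involutive hnn_wordV.
Proof.
move=> u; rewrite /hnn_wordV map_rev revK -map_comp map_id_in //.
by case=> [a|b] _ /=; rewrite ?invgK ?negbK.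
Qed.

Lemma hnn_classM u v : hnn_class (u ++ v) = hnn_mulg (hnn_class u) (hnn_class v).
Proof.
by apply/hnn_classP/hnn_cat; apply/hnn_classP; rewrite hnn_classK.
Qed.

Fact hnn_mulgA : associative hnn_mulg.
Proof.
move=> x y z; rewrite -[x]hnn_classK -[y]hnn_classK -[z]hnn_classK.
by rewrite -!hnn_classM catA.
Qed.

Fact hnn_mul1g : left_id (hnn_class [::]) hnn_mulg.
Proof. by move=> x; rewrite -[x]hnn_classK -hnn_classM. Qed.

Fact hnn_mulg1 : right_id (hnn_class [::]) hnn_mulg.
Proof. by move=> x; rewrite -[x]hnn_classK -hnn_classM cats0. Qed.

Fact hnn_mulgV : right_inverse (hnn_class [::]) hnn_invg hnn_mulg.
Proof.
move=> x; rewrite -[X in hnn_mulg X]hnn_classK -hnn_classM.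
exact/hnn_classP/hnn_wordVr.
Qed.

Fact hnn_mulVg : left_inverse (hnn_class [::]) hnn_invg hnn_mulg.
Proof.
move=> x; rewrite -[X in hnn_mulg _ X]hnn_classK -hnn_classM.
apply/hnn_classP; rewrite -{2}[repr x]hnn_wordVK; exact: hnn_wordVr.
Qed.

HB.instance Definition _ :=
  isGroup.Build HNN hnn_mulgA hnn_mul1g hnn_mulg1 hnn_mulVg hnn_mulgV.

Definition hnn_base (a : L) : HNN := hnn_class [:: inl a].
Definition hnn_t : HNN := hnn_class [:: inr true].

Fact hnn_base_monoid_morphism : monoid.monoid_morphism hnn_base.
Proof.
split=> [|a b]; first exact/hnn_classP/hnn_one.
by rewrite -[RHS]hnn_classM; apply/esym/hnn_classP/hnn_mul.
Qed.

HB.instance Definition _ :=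
  isUMagmaMorphism.Build L HNN hnn_base hnn_base_monoid_morphism.

Lemma hnn_tVE : (hnn_t^-1)%g = hnn_class [:: inr false].
Proof.
apply: (mulgI hnn_t); rewrite mulgV -[RHS]hnn_classM.
exact/esym/hnn_classP/(hnn_tV true).
Qed.

Lemma hnn_relE (h : gsub H) :
  (hnn_t^-1 * hnn_base (val h) * hnn_t)%g = hnn_base (val (phi h)).
Proof.
rewrite hnn_tVE.
transitivity (hnn_class (([:: inr false] ++ [:: inl (val h)]) ++ [:: inr true])).
  by rewrite !hnn_classM.
exact/hnn_classP/hnn_conj.
Qed.

(* Universal property of the presentation. *)
Section Universal.
Variables (G : groupType) (f : UMagmaMorphism.type L G) (s : G).
Hypothesis fs : forall h : gsub H, (s^-1 * f (val h) * s)%g = f (val (phi h)).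

Let ev_letter (l : (L + bool)%type) : G :=
  match l with inl a => f a | inr true => s | inr false => s^-1%g end.
Let ev (u : hnn_word) : G := foldr (fun l x => (ev_letter l * x)%g) 1%g u.

Let ev_cat u v : ev (u ++ v) = (ev u * ev v)%g.
Proof. by elim: u => [|l u IH] /=; rewrite ?mul1g // IH mulgA. Qed.

Let ev_eqv u v : hnn_eqv u v -> ev u = ev v.
Proof.
elim=> {u v} //=.
- by move=> u v w _ -> _ ->.
- by move=> u u' v v' _ uu' _ vv'; rewrite !ev_cat uu' vv'.
- by rewrite gmulf1 mulg1.
- by move=> a b; rewrite !mulg1 gmulfM.
- by case; rewrite /= mulg1 ?mulgV ?mulVg.
- by move=> h; rewrite !mulg1 -fs mulgA.
Qed.

Lemma hnn_universal :
  exists F : HNN -> G, [/\ {morph F : x y / (x * y)%g},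
    (forall a, F (hnn_base a) = f a) & F hnn_t = s].
Proof.
have evc u : ev (repr (hnn_class u)) = ev u.
  by apply/ev_eqv/hnn_classP; rewrite hnn_classK.
exists (ev \o repr); split=> [x y|a|] /=.
- by rewrite evc ev_cat.
- by rewrite evc /= mulg1.
- by rewrite evc /= mulg1.
Qed.

End Universal.

(* HNN is generated by L and t. *)
Lemma hnn_ind (P : HNN -> Prop) :
  P 1%g -> (forall a x, P x -> P (hnn_base a * x)%g) ->
  (forall x, P x -> P (hnn_t * x)%g) -> (forall x, P x -> P (hnn_t^-1 * x)%g) ->
  forall x, P x.
Proof.
move=> P1 Pb Pt PtV x; rewrite -[x]hnn_classK.
elim: (repr x) => [|l u IH] //; rewrite -cat1s hnn_classM.
by case: l => [a|[]]; [exact: Pb | exact: Pt | rewrite -hnn_tVE; exact: PtV].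
Qed.

Lemma hnn_countable : countable [set: L] -> countable [set: HNN].
Proof.
move=> /countable_injP[f finj].
pose g (l : (L + bool)%type) : (nat + bool)%type :=
  match l with inl a => inl (f a) | inr b => inr b end.
have ginj : injective g.
  move=> [a|a] [b|b] //= [] => [fab|->//].
  by congr inl; apply: finj fab; rewrite in_setT.
apply/countable_injP; exists (fun x : HNN => pickle (map g (repr x))).
move=> x y _ _ /(pcan_inj pickleK) /(inj_map ginj) xy.
by rewrite -[x]hnn_classK xy hnn_classK.
Qed.

End HNN.

(* ell^infty(X) as a complex vector space; the type of complex numbers is R[i],
   whose order 0 <= z means that z is real and nonnegative. *)

Section Linfty.
Variables (R : realType) (X : Type).

Definition linf_pred : {pred X -> R[i]^o} := [pred f | `[< bounded_fun f >]].

Lemma linf_predP (f : X -> R[i]^o) :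
  reflect (exists M, forall x, `|f x| <= M)%R (f \in linf_pred).
Proof.
apply: (iffP (asboolP _)) => [[M [Mr fM]]|[M fM]].
  by exists (M + 1)%R => x; apply: (fM (M + 1)%R) => //; rewrite ltrDl.
exists `|M|%R; split=> [|N MN x _]; first exact: normr_real.
have M0 : (0 <= M)%R by exact: le_trans (normr_ge0 _) (fM x).
by apply: le_trans (fM x) (ltW _); rewrite -(ger0_norm M0).
Qed.

Fact linf_submod_closed : submod_closed linf_pred.
Proof.
split=> [|a f g /linf_predP[M fM] /linf_predP[N gN]]; apply/linf_predP.
  by exists 0%R => x; rewrite normr0.
exists (`|a| * M + N)%R => x; apply: le_trans (ler_normD _ _) _.
by apply: lerD => //; rewrite normrM ler_wpM2l.
Qed.

HB.instance Definition _ :=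
  GRing.isSubmodClosed.Build R[i] (X -> R[i]^o) linf_pred linf_submod_closed.

Definition linf : Type := {f : X -> R[i]^o | f \in linf_pred}.

HB.instance Definition _ := SubChoice.on linf.
HB.instance Definition _ := [SubChoice_isSubLmodule of linf by <:].

Lemma linf_one_subproof : (fun _ : X => 1%R : R[i]^o) \in linf_pred.
Proof. by apply/linf_predP; exists 1%R => x; rewrite normr1. Qed.

Definition linf_one : linf := Sub (fun _ : X => 1%R : R[i]^o) linf_one_subproof.

Lemma linf_comp_subproof (f : linf) (s : X -> X) : (val f \o s) \in linf_pred.
Proof.
by case: f => f /= /linf_predP[M fM]; apply/linf_predP; exists M => x; exact: fM.
Qed.

Definition linf_comp (f : linf) (s : X -> X) : linf :=
  Sub (val f \o s) (linf_comp_subproof f s).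

End Linfty.

(* Countability of G is not part of the predicate: it is a standing assumption,
   satisfied by HNN extensions of countable groups ([hnn_countable]). *)

Section InnerAmenable.
Variable G : groupType.

Definition gstar : Type := {x : G | x != 1%g}.

HB.instance Definition _ := SubChoice.on gstar.

Lemma gstar_conj_subproof (g : G) (x : gstar) : (g * val x * g^-1 != 1)%g.
Proof. by rewrite -mulgA -{1}(invgK g) -conjgE conjg_eq1 (valP x). Qed.

Definition gstar_conj (g : G) (x : gstar) : gstar :=
  Sub (g * val x * g^-1)%g (gstar_conj_subproof g x).

Definition inner_amenable (R : realType) : Prop :=
  (forall x : G, x = 1%g) \/
  exists m : {scalar linf R gstar},
    [/\ forall f, (forall x, 0 <= val f x)%R -> (0 <= m f)%R,
        m (linf_one R gstar) = 1%R &
        forall g f, m (linf_comp f (gstar_conj g^-1)) = m f].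

End InnerAmenable.

(* Main.v *)
Require Import Defs.
From HB Require Import structures.
From mathcomp Require Import all_boot all_order all_algebra.
From mathcomp Require Import all_classical all_reals all_analysis.
From mathcomp Require Import complex.
Import Order.TTheory GRing.Theory Num.Theory.
Import numFieldNormedType.Exports.
Set Implicit Arguments.
Unset Strict Implicit.
Unset Printing Implicit Defensive.

(** Write L for the base group, t for the stable letter and G for the HNN
extension.  A chain h_0, ..., h_n of nontrivial central elements of L with
h_i = phi h_(i-1) gives, in G, elements that commute with L and satisfy
t^-1 h_(i-1) t = h_i.  The uniform measures on longer and longer chains are
therefore fixed by conjugation by L, and conjugation by t^-1 only moves the two
end points, so the averages of a bounded f and of f o Ad(t^-1) differ by at most
2 sup |f| / (n + 1).  A limit of these averages along a nonprincipal ultrafilter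
on nat ([exists_asymptotic_mean]) is a mean invariant under L and t, hence under
the group G that they generate ([inner_amenable_of_chains]).

The chains must avoid the identity of G, which holds because L embeds in G
([hnn_base_inj]).  For countable L the embedding needs no normal form theorem:
L acts freely on L * nat, where every subgroup H of L has countably infinitely
many orbits, so that L * nat is isomorphic, as an H-set, to H * nat
([exists_free_coordinates]).  Hence L * nat with H acting by translation and
L * nat with H acting through phi are isomorphic H-sets, and sending t to such
an isomorphism extends the action of L to an action of G.  As L acts freely, no
nontrivial element of L dies in G. *)

Local Open Scope classical_set_scope.
Local Open Scope ring_scope.

(** * Limits of bounded complex sequences along an ultrafilter *)

Section Ultralimit.
Variable R : realType.
Local Notation Re := (@complex.Re R).
Local Notation Im := (@complex.Im R).

(** Any ultrafilter finer than the Frechet filter works, by compactness of the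
segments of R. *)
Lemma exists_limit_filter : exists U : set_system nat,
  [/\ ProperFilter U, \oo `<=` U &
      forall (u : nat -> R) (M : R), (forall n, `|u n| <= M) -> cvg (u @ U)].
Proof.
have [U [UU oU]] := ultraFilterLemma (F := \oo) _.
have UP : ProperFilter U by exact: ultra_proper.
exists U; split=> // u M uM.
have UI : (u @ U) `[- M, M]%classic.
  apply: (@filterS _ U _ setT) => [n _|]; last exact: filterT.
  by rewrite /= in_itv /= -ler_norml.
have [l [_ ul]] := segment_compact _ UI.
apply/cvg_ex; exists l => A lA.
(* An ultrafilter converges to each of its cluster points. *)
have [//|UnA] := in_ultra_setVsetC (u @^-1` A) UU.
by have [x [/= xA]] := ul (~` A) A UnA lA.
Qed.

Variable U : set_system nat.
Hypothesis UP : ProperFilter U.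

(** Complex limits are taken coordinatewise, so that compactness and order
closedness are only used on the real line. *)
Definition clim (z : nat -> R[i]) : R[i] :=
  Complex (lim ((Re \o z) @ U)) (lim ((Im \o z) @ U)).

Definition ccvg (z : nat -> R[i]) (l : R[i]) : Prop :=
  (Re \o z) @ U --> Re l /\ (Im \o z) @ U --> Im l.

Lemma clim_unique z l : ccvg z l -> clim z = l.
Proof.
by case: l => a b [/= za zb]; rewrite /clim (cvg_lim _ za) ?(cvg_lim _ zb).
Qed.

Lemma ReD (x y : R[i]) : Re (x + y) = Re x + Re y.
Proof. by case: x y => ? ? []. Qed.

Lemma ImD (x y : R[i]) : Im (x + y) = Im x + Im y.
Proof. by case: x y => ? ? []. Qed.

Lemma ReM (x y : R[i]) : Re (x * y) = Re x * Re y - Im x * Im y.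
Proof. by case: x y => ? ? []. Qed.

Lemma ImM (x y : R[i]) : Im (x * y) = Re x * Im y + Im x * Re y.
Proof. by case: x y => ? ? []. Qed.

Lemma ccvg_scalar a z w k l :
  ccvg z k -> ccvg w l -> ccvg (fun n => a * z n + w n) (a * k + l).
Proof.
move=> [zr zi] [wr wi]; split.
  have -> : Re \o (fun n => a * z n + w n) =
      (fun n => Re a * (Re \o z) n - Im a * (Im \o z) n + (Re \o w) n).
    by apply/funext => n /=; rewrite ReD ReM.
  by rewrite ReD ReM; apply: cvgD wr; apply: cvgB; apply: cvgMr.
have -> : Im \o (fun n => a * z n + w n) =
    (fun n => Re a * (Im \o z) n + Im a * (Re \o z) n + (Im \o w) n).
  by apply/funext => n /=; rewrite ImD ImM.
by rewrite ImD ImM; apply: cvgD wi; apply: cvgD; apply: cvgMr.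
Qed.

Lemma ccvg_cst a : ccvg (fun=> a) a.
Proof. by split; exact: cvg_cst. Qed.

Lemma ccvg_ge0 z l : (forall n, 0 <= z n) -> ccvg z l -> 0 <= l.
Proof.
move=> z0 [zr zi].
have z0' n : 0 <= Re (z n) /\ Im (z n) = 0.
  by have := z0 n; rewrite lecE /= => /andP[/eqP -> ->].
rewrite lecE /=; apply/andP; split.
  apply/eqP; rewrite -(cvg_lim _ zi) //.
  have -> : Im \o z = fun=> 0 by apply/funext => n /=; case: (z0' n).
  by apply: cvg_lim => //; exact: cvg_cst.
rewrite -(cvg_lim _ zr) //; apply: limr_ge; first by apply/cvg_ex; exists (Re l).
by apply: nearW => n /=; case: (z0' n).
Qed.

Hypothesis oo_U : \oo `<=` U.
Hypothesis U_cvg :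
  forall (u : nat -> R) (M : R), (forall n, `|u n| <= M) -> cvg (u @ U).

Lemma norm_ReIm_le (z M : R[i]) : `|z| <= M -> `|Re z| <= Re M /\ `|Im z| <= Re M.
Proof.
move=> zM; have zr := le_trans (normc_ge_Re z) zM.
have zi : (`|Im z|)%:C%C <= M.
  apply: le_trans zM; have := normc_ge_Re (z * 'i%C).
  rewrite ReiNIm normrN normrM [`|'i%C|]normc_def /=.
  by rewrite expr0n expr1n add0r sqrtr1 mulr1.
by move: zr zi; rewrite !lecE /= => /andP[_ ->] /andP[_ ->].
Qed.

Lemma bounded_ccvg (z : nat -> R[i]) (M : R[i]) :
  (forall n, `|z n| <= M) -> ccvg z (clim z).
Proof.
move=> zM; split; apply: (U_cvg (M := Re M)) => n;
  by have [] := norm_ReIm_le (zM n).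
Qed.

Lemma ccvg0 (z : nat -> R[i]) (M : R[i]) :
  (forall n, `|z n| <= n.+1%:R^-1 * M) -> ccvg z 0.
Proof.
move=> zM.
have h0 : (fun n => Re M * harmonic n) @ \oo --> (0 : R).
  by rewrite -[0 in X in _ --> X](mulr0 (Re M)); apply: cvgMr; exact: cvg_harmonic.
have ReE n : Re (n.+1%:R^-1 * M) = Re M * harmonic n.
  by rewrite -(rmorph_nat (real_complex R)) -fmorphV ReM /= mul0r subr0 mulrC.
have u0 (u : nat -> R) : (forall n, `|u n| <= Re (n.+1%:R^-1 * M)) -> u @ U --> 0.
  move=> uM A A0; apply: oo_U; move: A A0.
  apply: (squeeze_cvgr _ _ h0); last by rewrite -oppr0; exact: cvgN h0.
  by apply: nearW => n; rewrite -ler_norml -ReE.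
by split; apply: u0 => n; have [] := norm_ReIm_le (zM n).
Qed.

End Ultralimit.

(** * Means that are limits of averages over longer and longer sequences *)

Section AsymptoticMean.
Variables (R : realType) (X : Type) (c : nat -> nat -> X).

(** [linf] consists of functions into the regular module R[i]^o; sums and norms
of values are formed in the field R[i] itself. *)
Definition values (f : linf R X) : X -> R[i] := val f.

Lemma values_bounded f : exists M : R[i], forall x, `|values f x| <= M.
Proof. exact/linf_predP/(valP f). Qed.

Definition average (f : linf R X) (n : nat) : R[i] :=
  n.+1%:R^-1 * \sum_(i < n.+1) values f (c n i).

Lemma average_scalar a f g n :
  average (a *: f + g) n = a * average f n + average g n.
Proof.
rewrite /average mulrCA -mulrDr; congr (_ * _).
by rewrite mulr_sumr -big_split.
Qed.

Lemma average_bounded f : exists M : R[i], forall n, `|average f n| <= M.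
Proof.
have [M fM] := values_bounded f; exists M => n.
rewrite normrM normfV normr_nat ler_pdivrMl ?ltr0n //.
apply: le_trans (ler_norm_sum _ _ _) _.
apply: (@le_trans _ _ (\sum_(i < n.+1) M)).
  by apply: ler_sum => i _; exact: fM.
by rewrite sumr_const card_ord mulr_natl.
Qed.

(** The ultralimit of the averages forgets any discrepancy that stays bounded
before the division by n + 1; the invariance of the mean comes from this. *)
Lemma exists_asymptotic_mean : exists m : {scalar linf R X},
  [/\ forall f, (forall x, 0 <= val f x) -> 0 <= m f,
      m (linf_one R X) = 1 &
      forall f g (M : R[i]),
        (forall n, `|\sum_(i < n.+1) (values f (c n i) - values g (c n i))| <= M) ->
        m f = m g].
Proof.
have [U [UP oU Ucvg]] := exists_limit_filter R.
have avg_cvg f : ccvg U (average f) (clim U (average f)).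
  by have [M fM] := average_bounded f; exact: bounded_ccvg fM.
pose m (f : linf R X) : R[i]^o := clim U (average f).
have m_scalar : scalar m.
  move=> a f g; apply: clim_unique; rewrite [average _](_ : _ =
    fun n => a * average f n + average g n); first exact: ccvg_scalar.
  by apply/funext => n; exact: average_scalar.
pose mL := GRing.isLinear.Build R[i] (linf R X) R[i]^o *%R m m_scalar.
exists (HB.pack_for {scalar linf R X} m mL); split=> /= [f f0||f g M fgM].
- apply: ccvg_ge0 (avg_cvg f) => n.
  by rewrite mulr_ge0 ?invr_ge0 ?ler0n ?sumr_ge0.
- apply: clim_unique; rewrite [average _](_ : _ = fun=> 1); first exact: ccvg_cst.
  apply/funext => n; rewrite /average /= sumr_const card_ord.
  by rewrite mulVf // pnatr_eq0.
- apply/eqP; rewrite -subr_eq0; apply/eqP.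
  have fg0 : ccvg U (average (- 1 *: g + f)) 0.
    apply: (ccvg0 oU (M := M)) => n.
    rewrite /average normrM normfV normr_nat ler_pM2l ?invr_gt0 ?ltr0n //.
    apply: le_trans (fgM n); rewrite le_eqVlt; apply/orP; left; apply/eqP.
    by congr `|_|; apply: eq_bigr => i _; rewrite /= addrC scaleN1r.
  by rewrite -(clim_unique UP fg0) [RHS]m_scalar mulN1r addrC.
Qed.

End AsymptoticMean.

(** * The base group embeds in the HNN extension *)

Section Embedding.
Local Open Scope group_scope.

Section Coordinates.
Variables (L : groupType) (H : groupClosed L).

(** [x / y] lies in [H] when x and y have the same right coset H x = H y; the
chosen representative depends on the coset only, because [xget] depends on the
extension of its predicate ([coset_repM]). *)
Definition coset_rep (x : L) : L := xget 1 [set y | x / y \in H]%classic.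

Lemma coset_rep_in x : x / coset_rep x \in H.
Proof.
apply: (xgetPex 1 (P := [set y | x / y \in H]%classic)).
by exists x; rewrite /= mulgV gpred1.
Qed.

Lemma coset_repM h x : h \in H -> coset_rep (h * x) = coset_rep x.
Proof.
move=> hH; rewrite /coset_rep; congr (xget 1 _).
by apply/seteqP; split=> y /=; rewrite -mulgA (gpredMl _ hH).
Qed.

Lemma coset_repK x : coset_rep (coset_rep x) = coset_rep x.
Proof.
by have := coset_repM (coset_rep x) (coset_rep_in x); rewrite mulgVK.
Qed.

(** The orbits of H in L * nat correspond to the pairs of a coset representative
and an integer.  The factor nat makes this set infinite even if H has finite
index; being countable, it can be numbered by nat, and x / coset_rep x is the
coordinate along the orbit. *)
Lemma exists_free_coordinates : countable [set: L]%classic ->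
  exists2 th : L * nat -> gsub H * nat, bijective th &
    forall h x n, th (val h * x, n) = (h * (th (x, n)).1, (th (x, n)).2).
Proof.
move=> Lc.
pose A : set (L * nat) := (range coset_rep `*` [set: nat])%classic.
(* A indexes the orbits. *)
have Ainf : infinite_set A.
  move=> /(finite_image snd); apply: contra_not infinite_nat.
  apply: sub_finite_set => n _.
  by exists (coset_rep 1, n) => //; split=> //; exists 1.
have Acount : countable A.
  by apply: countableX => //; apply: sub_countable Lc; exact: card_image_le.
have /card_set_bijP[e [_ einj esurj]] := eq_card_nat Acount Ainf.
have inA x n : A (coset_rep x, n) by split => //; exists x.
pose q x : gsub H := Sub (x / coset_rep x) (coset_rep_in x).
exists (fun p => (q p.1, e (coset_rep p.1, p.2))); last first.
  move=> h x n /=; rewrite coset_repM ?(valP h) //; congr pair.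
  by apply: val_inj; rewrite /= coset_repM ?(valP h) // mulgA.
rewrite -setTT_bijective; split=> //.
  move=> [x n] [y m] _ _ /= [qxy exy].
  have [rxy nm] : (coset_rep x, n) = (coset_rep y, m) by apply: einj; rewrite ?inE.
  by rewrite -[x](mulgVK (coset_rep x)) qxy rxy mulgVK nm.
move=> [h k] _; have [[r n] [[x _ /= rx] _] <-] := esurj k I; rewrite -{r}rx.
exists (val h * coset_rep x, n) => //=.
have hrep : coset_rep (val h * coset_rep x) = coset_rep x.
  by rewrite coset_repM ?coset_repK // (valP h).
by rewrite hrep; congr pair; apply: val_inj; rewrite /= hrep mulgK.
Qed.

End Coordinates.

Variables (L : groupType) (H K : groupClosed L).
Variable phi : Multiplicative.type (gsub H) (gsub K).

(** The stable letter acts on L * nat by the bijection s that is the inverse of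
phi when read from K-coordinates to H-coordinates: it intertwines translation by
phi h with translation by h, so words act compatibly with all the defining
relations. *)
Lemma hnn_base_inj : countable [set: L]%classic -> bijective phi ->
  injective (hnn_base phi).
Proof.
move=> Lc [psi phiK psiK].
have [tH [tH' tHK tHK'] tHM] := exists_free_coordinates H Lc.
have [tK [tK' tKK tKK'] tKM] := exists_free_coordinates K Lc.
pose mv a (y : L * nat) := (a * y.1, y.2).
pose s (y : L * nat) := tH' (psi (tK y).1, (tK y).2).
pose s' (y : L * nat) := tK' (phi (tH y).1, (tH y).2).
have sK : cancel s s'.
  by move=> y; rewrite /s /s' tHK' /= psiK -surjective_pairing tKK.
have s'K : cancel s' s.
  by move=> y; rewrite /s /s' tKK' /= phiK -surjective_pairing tHK.
have sM h y : s' (mv (val h) (s y)) = mv (val (phi h)) y.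
  rewrite /s' tHM -surjective_pairing tHK' /= gmulfM psiK.
  by apply: (can_inj tKK); rewrite tKK' tKM -surjective_pairing.
pose letter (l : L + bool) : L * nat -> L * nat :=
  match l with inl a => mv a | inr true => s | inr false => s' end.
pose act (u : hnn_word L) y := foldr letter y u.
have act_eqv u v : hnn_eqv phi u v -> forall y, act u y = act v y.
  elim=> {u v} //=.
  - by move=> u v w _ uv _ vw y; rewrite uv.
  - move=> u u' v v' _ uu' _ vv' y.
    by rewrite /act !foldr_cat -/(act v y) vv'; exact: uu'.
  - by move=> y; rewrite /act /= /mv mul1g -surjective_pairing.
  - by move=> a b y; rewrite /act /= /mv /= mulgA.
  - by case=> y; rewrite /act /= ?sK ?s'K.
move=> a b /hnn_classP /act_eqv /(_ (1, 0%N)).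
by rewrite /act /= /mv !mulg1 => -[].
Qed.

End Embedding.

(** * Invariant means from chains of central elements *)

Section Conjugation.
Local Open Scope group_scope.
Variables (R : realType) (G : groupType).

Lemma linf_comp_conjM (f : linf R (gstar G)) (x y : G) :
  linf_comp (linf_comp f (gstar_conj x)) (gstar_conj y) =
  linf_comp f (gstar_conj (x * y)).
Proof.
apply: val_inj; apply/funext => z /=; congr (val f _).
by apply: val_inj; rewrite /= invgM !mulgA.
Qed.

Lemma linf_comp_conj1 (f : linf R (gstar G)) : linf_comp f (gstar_conj 1) = f.
Proof.
apply: val_inj; apply/funext => z /=; congr (val f _).
by apply: val_inj; rewrite /= invg1 mulg1 mul1g.
Qed.

End Conjugation.

Section Chains.
Local Open Scope group_scope.
Variables (R : realType) (L : groupType) (H K : groupClosed L).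
Variable phi : gsub H -> gsub K.
Local Notation G := (HNN phi).

(** Conjugation by t^-1 shifts each chain by one step, so summing f o Ad(t^-1) - f
along a chain telescopes to a difference of two values of f, whatever the length
of the chain. *)
Lemma inner_amenable_of_chains (c : nat -> nat -> gstar G) :
  (forall n i a, gstar_conj (hnn_base phi a) (c n i) = c n i) ->
  (forall n i, (i <= n)%N -> gstar_conj (hnn_t phi)^-1 (c n i) = c n i.+1) ->
  inner_amenable G R.
Proof.
move=> c_base c_t; right.
have [m [m_ge0 m1 m_eq]] := exists_asymptotic_mean R c.
exists m; split=> // g f.
pose inv g := forall f, m (linf_comp f (gstar_conj g)) = m f.
have inv1 : inv 1 by move=> f'; rewrite linf_comp_conj1.
have invM x y : inv x -> inv y -> inv (x * y).
  by move=> mx my f'; rewrite -linf_comp_conjM my mx.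
have invV x : inv x -> inv x^-1.
  by move=> mx f'; rewrite -mx linf_comp_conjM mulVg inv1.
have inv_base a : inv (hnn_base phi a).
  move=> f'; apply: (m_eq _ _ 0%R) => n.
  rewrite big1 ?normr0 // => i _.
  by rewrite /values /= c_base subrr.
have inv_t : inv (hnn_t phi).
  rewrite -[hnn_t phi]invgK; apply: invV => f'.
  have [M fM] := values_bounded f'; apply: (m_eq _ _ (M + M)%R) => n.
  have -> : (\sum_(i < n.+1)
      (values (linf_comp f' (gstar_conj (hnn_t phi)^-1)) (c n i)
        - values f' (c n i)) = values f' (c n n.+1) - values f' (c n 0%N))%R.
    rewrite -(telescope_sumr (fun i => values f' (c n i))) // big_mkord.
    by apply: eq_bigr => i _; rewrite {1}/values /= c_t // -ltnS.
  by apply: le_trans (ler_normB _ _) _; exact: lerD.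
move: g^-1 f; elim/hnn_ind => [|a x|x|x].
- exact: inv1.
- exact: invM.
- exact: invM.
- by apply: invM; exact: invV.
Qed.

End Chains.

Theorem proposition0p2 (R : realType) (L : groupType) (L_countable : countable [set: L])
    (H K : groupClosed L) (phi : Multiplicative.type (gsub H) (gsub K))
    (phi_bij : bijective phi) :
  (forall n : nat, (1 <= n)%N -> exists h : nat -> gsub H,
    (forall i, (i <= n)%N ->
      [/\ gcenter L (val (h i)), val (h i) \in K & val (h i) != 1%g]) /\
    (forall i, (1 <= i <= n)%N -> val (h i) = val (phi (h i.-1)))) ->
  inner_amenable (HNN phi) R.
Proof.
move=> chains.
have {chains} /choice[c cP] n : exists c : nat -> gstar (HNN phi),
    (forall i a, gstar_conj (hnn_base phi a) (c i) = c i) /\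
    (forall i, (i <= n)%N -> gstar_conj (hnn_t phi)^-1%g (c i) = c i.+1).
  have [h [hZ hphi]] := chains n.+1 isT.
  (* Level n uses a chain with indices up to n.+1, so that the n.+1 averaged
     elements all have a successor; past its end the chain is constant. *)
  pose z i := val (h (minn i n.+1)).
  have zP i : gcenter L (z i) /\ (hnn_base phi (z i) != 1)%g.
    have [zZ _ z1] := hZ _ (geq_minr i n.+1); split=> //.
    have <- : hnn_base phi 1%g = 1%g by exact: gmulf1.
    by rewrite (inj_eq (hnn_base_inj L_countable phi_bij)).
  exists (fun i => Sub (hnn_base phi (z i)) (zP i).2); split=> [i a|i le_in].
    apply: val_inj; rewrite /= -gmulfM.
    by rewrite -(proj1 (zP i) a) gmulfM mulgK.
  apply: val_inj; rewrite /= invgK /z (minn_idPl (leqW le_in)).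
  by rewrite (minn_idPl (le_in : i.+1 <= n.+1)%N) hnn_relE (hphi i.+1).
by apply: (@inner_amenable_of_chains _ _ _ _ _ c) => n; have [] := cP n.
Qed.
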